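(* Consider the online problem and the OSPHG algorithm described in the context, where the window length $W=W(T)$ (a positive integer with $W\le T$) satisfies $W=o(T)$, and where $F,G,\beta,R,L$ are regarded as constants independent of $T$. Run OSPHG with $\mu=\frac{R}{\beta\sqrt{WT}}$, $\delta=4\beta^2$, and $K$ a positive integer of order $\sqrt{T/W}$ (that is, $K=\Theta(\sqrt{T/W})$). Then the total budget violation $$C_T=\sum_{t=1}^T g_t(x_t)=\sum_{t=1}^T\langle p_t,x_t\rangle-B_T$$ satisfies $C_T\le\mathcal O(W^{\frac14}T^{\frac34})$ as $T\to\infty$, i.e. there is a constant $C$ depending only on $F,G,\beta,R,L$ and the constants in the choice of $K$ such that $C_T\le C\,W^{1/4}T^{3/4}$ for all sufficiently large $T$. In particular, if $W=T^{1-\epsilon}$ with $0<\epsilon\le1$, OSPHG achieves a sub-linear budget violation bound of $\mathcal O(T^{1-\frac{\epsilon}{4}})$.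
   Context: **Problem.** Let $T$ be the horizon, $B_T\ge 0$ a total budget, and $\mathcal X\subset\mathbb R_+^n$ a compact convex set with $0\in\mathcal X$ and diameter at most $R$: $\max_{x,y\in\mathcal X}\|x-y\|\le R$ (Euclidean norm). For each $t\in[T]=\{1,\dots,T\}$ there are: a differentiable utility $f_t:\mathcal X\to\mathbb R$ that is normalized ($f_t(0)=0$), monotone ($x\preceq y\Rightarrow f_t(x)\le f_t(y)$, with $\preceq$ the entrywise order) and DR-submodular ($x\succeq y\Rightarrow\nabla f_t(x)\preceq\nabla f_t(y)$); and a constraint function $g_t(x)=\langle p_t,x\rangle-\frac{B_T}{T}$ with $p_t\succeq 0$. At step $t$ the player chooses $x_t\in\mathcal X$ and only afterwards $f_t$ and $p_t$ are revealed (they may be adversarial). **Assumptions and constants.** For all $t$, $f_t$ and $g_t$ are Lipschitz on $\mathcal X$ (Euclidean norm) with constants $\beta_f$ and $\beta_g=\max_t\|p_t\|$, and $\beta=\max\{\beta_f,\beta_g\}$. Put $F=\max_{t}\max_{x,y\in\mathcal X}|f_t(x)-f_t(y)|$ and $G=\max_t\max_{x\in\mathcal X}|g_t(x)|$. Each $f_t$ is $L$-smooth in the sense that $f_t(x+u)-f_t(x)\ge\langle u,\nabla f_t(x)\rangle-\frac L2\|u\|^2$ whenever $x,x+u\in\mathcal X$ and $u\succeq0$ or $u\preceq 0$. **OSPHG algorithm** with parameters $\mu>0,\delta>0$ and positive integer $K$. Let $\mathcal L_t(x,\lambda)=f_t(x)-\lambda g_t(x)+\frac{\delta\mu}{2}\lambda^2$.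 Initialize $\lambda_1=0$ and $v_1^{(1)},\dots,v_1^{(K)}\in\mathcal X$ (initial points of $K$ instances of online gradient ascent). For $t=1,\dots,T$: set $x_t^{(1)}=0$ and $x_t^{(k+1)}=x_t^{(k)}+\frac1K v_t^{(k)}$ for $k=1,\dots,K$; play $x_t=x_t^{(K+1)}$; after $f_t,g_t$ are revealed, update $v_{t+1}^{(k)}=\mathcal P_{\mathcal X}\big(v_t^{(k)}+\mu\nabla_x\mathcal L_t(x_t^{(k)},\lambda_t)\big)$ for $k=1,\dots,K$, where $\mathcal P_{\mathcal X}$ is Euclidean projection onto $\mathcal X$, and $\lambda_{t+1}=\max\{0,\lambda_t-\mu\nabla_\lambda\mathcal L_t(x_t,\lambda_t)\}$. *)

(* Defs.v *)
From HB Require Import structures.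
From mathcomp Require Import all_boot all_order all_algebra.
From mathcomp Require Import all_classical all_reals all_analysis.
From mathcomp Require Import ring lra.

Set Implicit Arguments.
Unset Strict Implicit.
Unset Printing Implicit Defensive.

Import Order.TTheory GRing.Theory Num.Theory.
Import numFieldNormedType.Exports.

Local Open Scope classical_set_scope.
Local Open Scope ring_scope.

Section Euclidean.
Context {R : realType} {n : nat}.
Implicit Types (x y z u g : 'rV[R]_n) (X : set 'rV[R]_n) (f : 'rV[R]_n -> R).

Definition dot x y : R := \sum_i x 0 i * y 0 i.

(* The canonical norm `|x| of 'rV[R]_n is the sup norm, whence this one. *)
Definition enorm x : R := Num.sqrt (dot x x).

Definition vle x y : Prop := forall i, x 0 i <= y 0 i.

Definition is_max (A : set R) (m : R) : Prop := A m /\ ubound A m.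

(* Fréchet derivative relative to X, as f is only meaningful on X.
   If X has empty interior, g is determined only up to a vector orthogonal to
   the linear span of X - x. *)
Definition gradient_within X f x g : Prop :=
  forall e, 0 < e -> exists2 d, 0 < d & forall y, X y -> enorm (y - x) < d ->
    `|f y - f x - dot g (y - x)| <= e * enorm (y - x).

Definition elipschitz X f (k : R) : Prop :=
  forall x y, X x -> X y -> `|f x - f y| <= k * enorm (x - y).

Definition monotone X f : Prop :=
  forall x y, X x -> X y -> vle x y -> f x <= f y.

Definition dr_submodular X (gradf : 'rV[R]_n -> 'rV[R]_n) : Prop :=
  forall x y, X x -> X y -> vle y x -> vle (gradf x) (gradf y).

Definition dr_smooth X f (gradf : 'rV[R]_n -> 'rV[R]_n) (L : R) : Prop :=
  forall x u, X x -> X (x + u) -> vle 0 u \/ vle u 0 ->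
    f (x + u) - f x >= dot u (gradf x) - L / 2 * enorm u ^+ 2.

Definition projection X y p : Prop :=
  X p /\ forall z, X z -> enorm (y - p) <= enorm (y - z).

End Euclidean.

(* Sequences indexed by rounds are only meaningful for 1 <= t <= T. *)
Record problem (R : realType) (n : nat) := Problem {
  feasible : set 'rV[R]_n ;
  budget : R ;
  utility : nat -> 'rV[R]_n -> R ;
  grad_utility : nat -> 'rV[R]_n -> 'rV[R]_n ;
  price : nat -> 'rV[R]_n
}.

Section Problem.
Context {R : realType} {n : nat}.
Variables (P : problem R n) (T : nat).
Local Notation X := (feasible P).

Definition constraint (t : nat) (x : 'rV[R]_n) : R :=
  dot (price P t) x - budget P / T%:R.

Record online_problem : Prop := OnlineProblem {
  feasible_compact : compact X ;
  feasible_convex : convex_set X ;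
  feasible_ge0 : forall x, X x -> vle 0 x ;
  feasible0 : X 0 ;
  budget_ge0 : 0 <= budget P ;
  utility_grad : forall t x, (1 <= t <= T)%N -> X x ->
    gradient_within X (utility P t) x (grad_utility P t x) ;
  utility0 : forall t, (1 <= t <= T)%N -> utility P t 0 = 0 ;
  utility_monotone : forall t, (1 <= t <= T)%N -> monotone X (utility P t) ;
  utility_dr : forall t, (1 <= t <= T)%N -> dr_submodular X (grad_utility P t) ;
  price_ge0 : forall t, (1 <= t <= T)%N -> vle 0 (price P t)
}.

Record problem_constants (F G beta Rad L : R) : Prop := ProblemConstants {
  diameter_le : forall x y, X x -> X y -> enorm (x - y) <= Rad ;
  lipschitz_beta : exists betaf betag : R,
    [/\ forall t, (1 <= t <= T)%N -> elipschitz X (utility P t) betaf,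
        forall t, (1 <= t <= T)%N -> elipschitz X (constraint t) betag,
        is_max [set enorm (price P t) | t in [set t | (1 <= t <= T)%N]] betag &
        beta = Num.max betaf betag] ;
  utility_range : is_max
    [set r | exists t x y, [/\ (1 <= t <= T)%N, X x, X y &
                             r = `|utility P t x - utility P t y|]] F ;
  constraint_range : is_max
    [set r | exists t x, [/\ (1 <= t <= T)%N, X x &
                           r = `|constraint t x|]] G ;
  utility_smooth : forall t, (1 <= t <= T)%N ->
    dr_smooth X (utility P t) (grad_utility P t) L
}.

Definition lagrangian (mu delta : R) (t : nat) (x : 'rV[R]_n) (lam : R) : R :=
  utility P t x - lam * constraint t x + delta * mu / 2 * lam ^+ 2.

Definition grad_lagrangian (t : nat) (x : 'rV[R]_n) (lam : R) : 'rV[R]_n :=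
  grad_utility P t x - lam *: price P t.

Lemma grad_lagrangianP mu delta t x lam :
  gradient_within X (utility P t) x (grad_utility P t x) ->
  gradient_within X (fun y => lagrangian mu delta t y lam) x
    (grad_lagrangian t x lam).
Proof.
move=> h e /h[d d0 hd]; exists d => // y Xy yx.
have dotB (a b c : 'rV[R]_n) : dot (a - lam *: b) c = dot a c - lam * dot b c.
  by rewrite /dot mulr_sumr -sumrB; apply: eq_bigr => i _; rewrite !mxE; ring.
have dotBr (a b c : 'rV[R]_n) : dot a (b - c) = dot a b - dot a c.
  by rewrite /dot -sumrB; apply: eq_bigr => i _; rewrite !mxE; ring.
apply: le_trans (hd y Xy yx); rewrite le_eqVlt; apply/orP; left; apply/eqP.
congr (`| _ |); rewrite /lagrangian /grad_lagrangian /constraint dotB.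
by rewrite (dotBr (price P t)); ring.
Qed.

End Problem.

(* [direction t k] is v_t^(k) and [iterate t k] is x_t^(k). *)
Record trajectory (R : realType) (n : nat) := Trajectory {
  dual : nat -> R ;
  direction : nat -> nat -> 'rV[R]_n ;
  iterate : nat -> nat -> 'rV[R]_n
}.

Record osphg {R : realType} {n : nat} (P : problem R n) (T : nat)
    (mu delta : R) (K : nat) (S : trajectory R n) : Prop := Osphg {
  mu_gt0 : 0 < mu ;
  delta_gt0 : 0 < delta ;
  K_gt0 : (0 < K)%N ;
  dual_init : dual S 1 = 0 ;
  direction_init : forall k, (1 <= k <= K)%N -> feasible P (direction S 1 k) ;
  iterate_init : forall t, (1 <= t <= T)%N -> iterate S t 1 = 0 ;
  iterate_step : forall t k, (1 <= t <= T)%N -> (1 <= k <= K)%N ->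
    iterate S t k.+1 = iterate S t k + K%:R^-1 *: direction S t k ;
  direction_step : forall t k, (1 <= t <= T)%N -> (1 <= k <= K)%N ->
    projection (feasible P)
      (direction S t k + mu *: grad_lagrangian P t (iterate S t k) (dual S t))
      (direction S t.+1 k) ;
  dual_step : forall t, (1 <= t <= T)%N ->
    dual S t.+1 =
    Num.max 0 (dual S t -
      mu * derive1 (lagrangian P T mu delta t (iterate S t K.+1)) (dual S t))
}.

Definition violation {R : realType} {n : nat} (P : problem R n) (T K : nat)
    (S : trajectory R n) : R :=
  \sum_(1 <= t < T.+1) constraint P T t (iterate S t K.+1).

Lemma violationE (R : realType) (n : nat) (P : problem R n) (T K : nat)
    (S : trajectory R n) : (0 < T)%N ->
  violation P T K S =
  \sum_(1 <= t < T.+1) dot (price P t) (iterate S t K.+1) - budget P.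
Proof.
move=> T0; rewrite /violation sumrB sumr_const_nat subSS subn0 -[X in _ - X]mulr_natr.
by rewrite divfK // pnatr_eq0 -lt0n.
Qed.

Definition osphg_violation_le {R : realType} (F G beta Rad L : R) (T : nat)
    (mu delta : R) (K : nat) (bound : R) : Prop :=
  forall (n : nat) (P : problem R n) (S : trajectory R n),
    online_problem P T ->
    problem_constants P T F G beta Rad L ->
    osphg P T mu delta K S ->
    violation P T K S <= bound.

(* Main.v *)
Require Import Defs.
From HB Require Import structures.
From mathcomp Require Import all_boot all_order all_algebra.
From mathcomp Require Import all_classical all_reals all_analysis.
From mathcomp Require Import ring lra.

(* Compare the primal iterates with the point 0 and the dual iterates with a
   fixed multiplier lam >= 0, through the potential
     K^-1 * sum_k |v_t^(k)|^2 + (lam_t - lam)^2.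
   At 0 the constraint is nonpositive, and <grad f_t, v> <= beta * Rad, so one
   round decreases the potential by 2 mu lam g_t(x_t) up to an error
   O(mu + mu^2 + mu^2 lam^2): the terms in lam_t^2 are absorbed by the
   regularizer delta = 4 beta^2 as soon as 16 beta^2 mu^2 <= 1, that is, for
   T >= 16 Rad^2. Telescoping bounds C_T by O(T / lam + lam * sqrt (W * T)), and
   lam = (T / W)^(1/4) gives W^(1/4) T^(3/4). *)

Set Implicit Arguments.
Unset Strict Implicit.
Unset Printing Implicit Defensive.

Import Order.TTheory GRing.Theory Num.Theory.
Import numFieldNormedType.Exports.

Local Open Scope classical_set_scope.
Local Open Scope ring_scope.

(** * Inner products, projections and relative gradients *)

Section EuclideanGeometry.
Context {R : realType} {n : nat}.
Implicit Types (x y z u v w p g : 'rV[R]_n) (X : set 'rV[R]_n).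

Lemma dotC x y : dot x y = dot y x.
Proof. by apply: eq_bigr => i _; rewrite mulrC. Qed.

Lemma dotDl x y z : dot (x + y) z = dot x z + dot y z.
Proof. by rewrite /dot -big_split; apply: eq_bigr => i _; rewrite !mxE mulrDl. Qed.

Lemma dotZl (a : R) x y : dot (a *: x) y = a * dot x y.
Proof. by rewrite /dot mulr_sumr; apply: eq_bigr => i _; rewrite !mxE mulrA. Qed.

Lemma dotNl x y : dot (- x) y = - dot x y.
Proof. by rewrite -scaleN1r dotZl mulN1r. Qed.

Lemma dotDr x y z : dot x (y + z) = dot x y + dot x z.
Proof. by rewrite dotC dotDl !(dotC x). Qed.

Lemma dotZr (a : R) x y : dot x (a *: y) = a * dot x y.
Proof. by rewrite dotC dotZl dotC. Qed.

Lemma dotNr x y : dot x (- y) = - dot x y.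
Proof. by rewrite dotC dotNl dotC. Qed.

Definition dotE := (dotDl, dotDr, dotNl, dotNr, dotZl, dotZr).

Lemma dot0r x : dot x 0 = 0.
Proof. by rewrite -(scale0r x) dotZr mul0r. Qed.

Lemma dot_sumr x (I : Type) (r : seq I) (F : I -> 'rV[R]_n) :
  dot x (\sum_(i <- r) F i) = \sum_(i <- r) dot x (F i).
Proof.
elim: r => [|i r IH]; first by rewrite !big_nil dot0r.
by rewrite !big_cons dotDr IH.
Qed.

Lemma dot_ge0 x : 0 <= dot x x.
Proof. by apply: sumr_ge0 => i _; rewrite -expr2 sqr_ge0. Qed.

Lemma enorm_ge0 x : 0 <= enorm x.
Proof. exact: sqrtr_ge0. Qed.

Lemma sqr_enorm x : enorm x ^+ 2 = dot x x.
Proof. by rewrite sqr_sqrtr // dot_ge0. Qed.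

Lemma enormZ (a : R) x : 0 <= a -> enorm (a *: x) = a * enorm x.
Proof.
move=> a0; rewrite /enorm !dotE mulrA -expr2 sqrtrM ?sqr_ge0 //.
by rewrite sqrtr_sqr ger0_norm.
Qed.

Lemma convex_segment X x y (s : R) : convex_set X -> X x -> X y ->
  0 <= s <= 1 -> X (x + s *: (y - x)).
Proof.
move=> cX Xx Xy /andP[s0 s1].
have := cX y x (Itv01 s0 s1); rewrite !inE => /(_ Xy Xx).
suff -> : x + s *: (y - x) = s *: y + (1 - s) *: x by [].
by rewrite scalerBr scalerBl scale1r addrCA addrC -addrA [- _ + _]addrC.
Qed.

(** First-order optimality of the nearest point: moving from [p] towards [u] by a fraction [s]
    changes the squared distance to [y] by [- 2 s d + s^2 q], which would be negative for small [s]
    if [d > 0]. *)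
Lemma projection_obtuse X y p u : convex_set X -> projection X y p -> X u ->
  dot (y - p) (u - p) <= 0.
Proof.
move=> cX [Xp minp] Xu; rewrite leNgt; apply/negP => d_gt0.
pose d := dot (y - p) (u - p); pose q := dot (u - p) (u - p).
have q0 : 0 <= q by exact: dot_ge0.
(* This choice lies in [0, 1] and gives [s * q = d - s * d < 2 * d], with no case split on
   [q = 0]. *)
pose s := d / (d + q).
have dq : 0 < d + q by rewrite ltr_wpDr.
have s01 : 0 <= s <= 1.
  by rewrite divr_ge0 ?(ltW dq) ?(ltW d_gt0) //= ler_pdivrMr // mul1r lerDl.
have := minp _ (convex_segment cX Xp Xu s01).
have -> : y - (p + s *: (u - p)) = (y - p) - s *: (u - p) by rewrite opprD addrA.
rewrite -(ler_pXn2r (n := 2)) ?nnegrE ?enorm_ge0 // !sqr_enorm.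
have sqrB (a b : 'rV[R]_n) : dot (a - s *: b) (a - s *: b)
    = dot a a - 2 * s * dot a b + s ^+ 2 * dot b b.
  by rewrite !dotE (dotC b a); ring.
rewrite sqrB -/d -/q.
have sq : s * d + s * q = d by rewrite /s -mulrDr divfK // gt_eqF.
have sgt0 : 0 < s by rewrite divr_gt0.
have d0 : 0 < d by [].
nra.
Qed.

(* Only differences of points of X can be tested against g: g is not determined,
   nor its norm bounded, in the directions orthogonal to X. *)
Lemma gradient_within_le X f x g (k : R) y z : convex_set X ->
  elipschitz X f k -> gradient_within X f x g -> X x -> X y -> X z ->
  dot g (y - z) <= k * enorm (y - z).
Proof.
move=> cX fk fg Xx Xy Xz; pose N := enorm (y - x) + enorm (z - x).
have N0 : 0 <= N by rewrite addr_ge0 ?enorm_ge0.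
apply/ler_addgt0Pr => e e0.
have N1 : 0 < N + 1 by rewrite ltr_wpDl.
(* The points [y] and [z] may be far from [x], so both are contracted towards [x] by one factor [s]
   with [s * N < d]. The Lipschitz bound on the contracted pair scales by [s] and is divided by it
   at the end. The [+ 1] in the tolerance guards against [N = 0]. *)
have [d d0 hd] := fg (e / (N + 1)) (divr_gt0 e0 N1).
pose s := d / (d + N + 1).
have dN : 0 < d + N + 1 by rewrite -addrA addr_gt0.
have s0 : 0 < s by rewrite divr_gt0.
have s01 : 0 <= s <= 1.
  by rewrite (ltW s0) /= ler_pdivrMr // mul1r -addrA lerDl ltW.
have small w : enorm (w - x) <= N -> enorm (x + s *: (w - x) - x) < d.
  move=> wN; rewrite addrC addKr enormZ ?(ltW s0) //.
  by rewrite /s mulrAC ltr_pdivrMr // ltr_pM2l //; lra.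
have near w : X w -> enorm (w - x) <= N ->
    `|f (x + s *: (w - x)) - f x - s * dot g (w - x)|
      <= e / (N + 1) * (s * enorm (w - x)).
  move=> Xw wN.
  have := hd _ (convex_segment cX Xx Xw s01) (small w wN).
  by rewrite [_ + _ - x]addrC addKr dotZr enormZ ?(ltW s0).
have := near y Xy; rewrite lerDl enorm_ge0 => /(_ isT).
have := near z Xz; rewrite lerDr enorm_ge0 => /(_ isT).
have := fk _ _ (convex_segment cX Xx Xy s01) (convex_segment cX Xx Xz s01).
have -> : x + s *: (y - x) - (x + s *: (z - x)) = s *: (y - z).
  by rewrite opprD addrACA subrr add0r -scalerBr opprB addrA subrK.
rewrite enormZ ?(ltW s0) // !ler_norml => /andP[_ h1] /andP[_ h2] /andP[h3 _].
have -> : dot g (y - z) = dot g (y - x) - dot g (z - x).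
  by rewrite !dotE; ring.
have eN : e / (N + 1) * (s * enorm (y - x)) + e / (N + 1) * (s * enorm (z - x)) <= s * e.
  rewrite -mulrDr -mulrDr -/N mulrCA ler_pM2l // mulrAC ler_pdivrMr // ler_pM2l //.
  by rewrite lerDl.
rewrite -(ler_pM2l s0); move: h1 h2 h3 eN; lra.
Qed.

(** The obtuse angle at [u = 0] leaves the error [2 mu <g, v' - v> - |v' - v|^2], at most [mu^2 c^2]
    by completing the square. Only the component of [g] along [v' - v] has to be bounded, which is
    all that a relative gradient provides. *)
Lemma projected_ascent_step X v v' g (mu c : R) : convex_set X -> X 0 ->
  0 <= mu -> X v -> projection X (v + mu *: g) v' ->
  dot g (v' - v) <= c * enorm (v' - v) ->
  dot v' v' <= dot v v + 2 * mu * dot g v + mu ^+ 2 * c ^+ 2.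
Proof.
move=> cX X0 mu0 Xv pv' gc; have := projection_obtuse cX pv' X0.
have := sqr_enorm (v' - v); move: gc; set D := enorm _.
rewrite sub0r !dotE (dotC v' v) => gc D2.
have : 0 <= (mu * c - D) ^+ 2 by exact: sqr_ge0.
nra.
Qed.

End EuclideanGeometry.

Lemma derive1_lagrangian (R : realType) (n : nat) (P : problem R n) (T : nat)
    (mu delta : R) (t : nat) (x : 'rV[R]_n) (lam : R) :
  derive1 (lagrangian P T mu delta t x) lam =
  delta * mu * lam - constraint P T t x.
Proof.
rewrite derive1E.
have h : is_derive lam 1 (fun l : R => utility P t x - l * constraint P T t x
    + delta * mu / 2 * l ^+ 2) (delta * mu * lam - constraint P T t x).
  apply: is_derive_eq; rewrite /GRing.scale /=; by field.
by rewrite (@derive_val _ _ _ _ _ _ _ h).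
Qed.

(** * One run of the algorithm: feasibility, Lipschitz bounds and the potential *)

Section Run.
Context {R : realType} {n : nat}.
Variables (P : problem R n) (T : nat) (F G beta Rad L mu delta : R) (K : nat)
  (S : trajectory R n).
Hypotheses (HP : online_problem P T)
  (HC : problem_constants P T F G beta Rad L)
  (HS : osphg P T mu delta K S).
Local Notation X := (feasible P).

Lemma direction_feasible t k : (1 <= t <= T.+1)%N -> (1 <= k <= K)%N ->
  X (direction S t k).
Proof.
case: t => [//|[|t]] tT kK; first exact: (direction_init HS kK).
by have [] := direction_step HS (t := t.+1) tT kK.
Qed.

Lemma iterate_mean t k : (1 <= t <= T)%N -> (k <= K)%N ->
  iterate S t k.+1 = K%:R^-1 *: \sum_(1 <= j < k.+1) direction S t j.
Proof.
move=> tT; elim: k => [|k IH] kK.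
  by rewrite (iterate_init HS) // big_geq // scaler0.
by rewrite (iterate_step HS) // IH 1?ltnW // [in RHS]big_nat_recr //= scalerDr.
Qed.

Lemma iterate_feasible t k : (1 <= t <= T)%N -> (k <= K)%N ->
  X (iterate S t k.+1).
Proof.
move=> tT kK.
have [tT1 cX] : (1 <= t <= T.+1)%N /\ convex_set X.
  by split; [case/andP: tT => -> /leqW | exact: feasible_convex HP].
have X0 := feasible0 HP.
have K0 : 0 < K%:R :> R by rewrite ltr0n (K_gt0 HS).
(* Here [w] is the running mean of the first [k] directions, updated with weight [1 / (k + 1)].
   Shrinking it by [k / K] towards the feasible point 0 stays in [X]. *)
suff [w Xw ->] : exists2 w, X w & iterate S t k.+1 = (k%:R / K%:R) *: w.
  have := convex_segment (s := k%:R / K%:R) cX X0 Xw.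
  rewrite subr0 add0r; apply.
  by rewrite divr_ge0 //= ler_pdivrMr // mul1r ler_nat.
elim: k kK => [|k IH] kK.
  by exists 0 => //; rewrite (iterate_init HS) // scaler0.
have [w Xw ew] := IH (ltnW kK).
exists (w + k.+1%:R^-1 *: (direction S t k.+1 - w)).
  apply: convex_segment => //; first exact: direction_feasible.
  by rewrite invr_ge0 ler0n /= invf_le1 ?ltr0n // ler1n.
rewrite (iterate_step HS) // ew; apply/rowP => i; rewrite !mxE -natr1.
by field; rewrite natr1 (gt_eqF K0) pnatr_eq0.
Qed.

Lemma dual_ge0 t : (1 <= t <= T.+1)%N -> 0 <= dual S t.
Proof.
case: t => [//|[|t]] tT; first by rewrite (dual_init HS).
by rewrite (dual_step HS (t := t.+1) tT) le_max lexx.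
Qed.

Lemma beta_ge0 : (0 < T)%N -> 0 <= beta.
Proof.
move=> T0; have [bf [bg [_ _ [[t _ <-] _] ->]]] := lipschitz_beta HC.
by rewrite le_max enorm_ge0 orbT.
Qed.

Lemma grad_utility_le t x y z : (1 <= t <= T)%N -> X x -> X y -> X z ->
  dot (grad_utility P t x) (y - z) <= beta * enorm (y - z).
Proof.
move=> tT Xx Xy Xz; have [bf [bg [hf _ _ ->]]] := lipschitz_beta HC.
apply: le_trans (gradient_within_le (feasible_convex HP) (hf t tT)
  (utility_grad HP tT Xx) Xx Xy Xz) _.
by rewrite ler_wpM2r ?enorm_ge0 // le_max lexx.
Qed.

Lemma price_le t y z : (1 <= t <= T)%N -> X y -> X z ->
  - dot (price P t) (y - z) <= beta * enorm (y - z).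
Proof.
move=> tT Xy Xz; have [bf [bg [_ hg _ ->]]] := lipschitz_beta HC.
have := hg t tT y z Xy Xz; rewrite ler_norml => /andP[h _].
apply: (@le_trans _ _ (bg * enorm (y - z))); last first.
  by rewrite ler_wpM2r ?enorm_ge0 // le_max lexx orbT.
by move: h; rewrite /constraint !dotE; lra.
Qed.

(** Averaging over the [K] ascent instances matches [iterate_mean]: the linear price terms of the
    instances average to the price of the played point. *)
Definition direction_energy t : R :=
  K%:R^-1 * \sum_(1 <= k < K.+1) dot (direction S t k) (direction S t k).

Lemma direction_energy_ge0 t : 0 <= direction_energy t.
Proof. by rewrite mulr_ge0 ?invr_ge0 // sumr_ge0 // => k _; exact: dot_ge0. Qed.

Lemma mean_const (c : R) : K%:R^-1 * \sum_(1 <= k < K.+1) c = c.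
Proof.
rewrite sumr_const_nat subn1 /= -(mulr_natl c) mulKf // pnatr_eq0 -lt0n.
exact: (K_gt0 HS).
Qed.

Lemma direction_energy_init : direction_energy 1 <= Rad ^+ 2.
Proof.
rewrite -[leRHS]mean_const ler_wpM2l ?invr_ge0 // !big_nat.
apply: ler_sum => k kK; have Xv := direction_init HS kK.
have := diameter_le HC Xv (feasible0 HP); rewrite subr0 => vR.
by rewrite -sqr_enorm ler_pXn2r ?nnegrE ?enorm_ge0 ?(le_trans _ vR) ?enorm_ge0.
Qed.

(** Each instance takes one projected ascent step, and the steps are averaged. The utility gradient
    is tested against [v - 0], whose norm is at most [Rad]; along feasible differences the
    Lagrangian gradient is bounded by [beta * (1 + dual S t)]. *)
Lemma direction_energy_step t : (1 <= t <= T)%N ->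
  direction_energy t.+1 <= direction_energy t + 2 * mu * (beta * Rad)
    - 2 * mu * dual S t * dot (price P t) (iterate S t K.+1)
    + mu ^+ 2 * (beta * (1 + dual S t)) ^+ 2.
Proof.
move=> tT; have tT1 : (1 <= t <= T.+1)%N by case/andP: tT => -> /leqW.
have cX := feasible_convex HP; have X0 := feasible0 HP.
have mu0 := mu_gt0 HS; have lam0 := dual_ge0 tT1.
have b0 : 0 <= beta by apply: beta_ge0; case/andP: tT; exact: leq_trans.
set c := beta * (1 + dual S t).
rewrite iterate_mean // dotZr dot_sumr.
set a := 2 * mu * (beta * Rad) + mu ^+ 2 * c ^+ 2; set b := 2 * mu * dual S t.
apply: (@le_trans _ _ (K%:R^-1 * \sum_(1 <= k < K.+1)
   (dot (direction S t k) (direction S t k)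
    - b * dot (price P t) (direction S t k) + a))); last first.
  rewrite le_eqVlt; apply/orP; left; apply/eqP.
  rewrite big_split sumrB /= mulrDr mean_const -mulr_sumr mulrBr -/(direction_energy t) /a.
  by ring.
rewrite ler_wpM2l ?invr_ge0 // !big_nat; apply: ler_sum => k kK.
have Xv := direction_feasible tT1 kK.
have pv := direction_step HS tT kK.
have Xv' : X (direction S t.+1 k) by case: pv.
have [j jK ek] : exists2 j, (j <= K)%N & k = j.+1.
  by case: (k) kK => [//|j] jK; exists j => //; exact: ltnW.
have Xx : X (iterate S t k) by rewrite ek; exact: iterate_feasible.
set v := direction S t k in Xv pv *; set v' := direction S t.+1 k in Xv' pv *.
have hc : dot (grad_lagrangian P t (iterate S t k) (dual S t)) (v' - v)
    <= c * enorm (v' - v).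
  rewrite /grad_lagrangian dotDl dotNl dotZl.
  have := grad_utility_le tT Xx Xv' Xv.
  have := ler_wpM2l lam0 (price_le tT Xv' Xv).
  by rewrite /c; lra.
have := projected_ascent_step cX X0 (ltW mu0) Xv pv hc.
rewrite /grad_lagrangian dotDl dotNl dotZl.
have := grad_utility_le tT Xx Xv X0.
have := ler_wpM2l b0 (diameter_le HC Xv X0); rewrite subr0 => h1 h2.
have := ler_wpM2l (ltW mu0) (le_trans h2 h1).
by rewrite /a /b; lra.
Qed.

(* Truncation at 0 is a projection, so it does not increase the distance to lam. *)
Lemma dual_gap_step (lam : R) t : 0 <= lam -> (1 <= t <= T)%N ->
  (dual S t.+1 - lam) ^+ 2 <= (dual S t - lam
    + mu * (constraint P T t (iterate S t K.+1) - delta * mu * dual S t)) ^+ 2.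
Proof.
move=> lam0 tT; rewrite (dual_step HS) // derive1_lagrangian.
have -> : dual S t - lam + mu * (constraint P T t (iterate S t K.+1)
      - delta * mu * dual S t) =
    dual S t - mu * (delta * mu * dual S t - constraint P T t (iterate S t K.+1))
      - lam by ring.
set y := _ - mu * _; case: (leP 0 y) => // y0.
by nra.
Qed.

Definition potential (lam : R) t : R :=
  direction_energy t + (dual S t - lam) ^+ 2.

Lemma potential_step (lam : R) t : delta = 4 * beta ^+ 2 ->
  16 * beta ^+ 2 * mu ^+ 2 <= 1 -> 0 <= lam -> (1 <= t <= T)%N ->
  2 * mu * lam * constraint P T t (iterate S t K.+1) <=
  - (potential lam t.+1 - potential lam t)
  + (2 * mu * (beta * Rad) + 2 * mu ^+ 2 * (beta ^+ 2 + G ^+ 2)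
     + 4 * beta ^+ 2 * mu ^+ 2 * lam ^+ 2).
Proof.
move=> deltaE small lam0 tT; have tT1 : (1 <= t <= T.+1)%N.
  by case/andP: tT => -> /leqW.
have mu0 := mu_gt0 HS; have d0 := dual_ge0 tT1.
have := direction_energy_step tT; have := dual_gap_step lam0 tT.
have bud : 0 <= mu * dual S t * (budget P / T%:R).
  by rewrite !mulr_ge0 ?(ltW mu0) ?invr_ge0 // (budget_ge0 HP).
have gG : constraint P T t (iterate S t K.+1) ^+ 2 <= G ^+ 2.
  have hG : `|constraint P T t (iterate S t K.+1)| <= G.
    have [_] := constraint_range HC; apply.
    by exists t, (iterate S t K.+1); split => //; exact: iterate_feasible.
  rewrite -[leLHS]real_normK ?num_real // ler_pXn2r ?nnegrE //.
  exact: le_trans hG.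
have -> : dot (price P t) (iterate S t K.+1) =
    constraint P T t (iterate S t K.+1) + budget P / T%:R.
  by rewrite /constraint subrK.
rewrite /potential deltaE; move: gG small d0 bud.
set g := constraint _ _ _ _; set d := dual S t; set B := budget P / _.
set e := direction_energy t; set e' := direction_energy _; set d' := (_ - lam) ^+ 2.
move=> gG small d0 bud hd he.
(* In units of [mu^2 beta^2 d^2], the regularizer gives - 8. Splitting [(1 + d)^2] costs 2 ([q1]),
   splitting the squared dual step costs 2 ([q2], [q4]), and the cross term [8 d lam] costs 4
   ([q5]). The balance is exactly zero. *)
have q1 : 0 <= (mu * beta * (1 - d)) ^+ 2 := sqr_ge0 _.
have q2 : 0 <= (mu * (g + 4 * beta ^+ 2 * mu * d)) ^+ 2 := sqr_ge0 _.
have q3 : 0 <= mu ^+ 2 * (G ^+ 2 - g ^+ 2).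
  by rewrite mulr_ge0 ?sqr_ge0 // subr_ge0.
have q4 : 0 <= (mu * beta * d) ^+ 2 * (1 - 16 * beta ^+ 2 * mu ^+ 2).
  by rewrite mulr_ge0 ?sqr_ge0 // subr_ge0.
have q5 : 0 <= (mu * beta * (d - lam)) ^+ 2 := sqr_ge0 _.
by nra.
Qed.

Lemma violation_le (lam : R) : delta = 4 * beta ^+ 2 ->
  16 * beta ^+ 2 * mu ^+ 2 <= 1 -> 0 <= lam ->
  2 * mu * lam * violation P T K S <=
  Rad ^+ 2 + lam ^+ 2
  + T%:R * (2 * mu * (beta * Rad) + 2 * mu ^+ 2 * (beta ^+ 2 + G ^+ 2)
            + 4 * beta ^+ 2 * mu ^+ 2 * lam ^+ 2).
Proof.
move=> deltaE small lam0; set c := 2 * mu * (beta * Rad) + _ + _.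
have -> : Rad ^+ 2 + lam ^+ 2 = Rad ^+ 2 + (dual S 1 - lam) ^+ 2.
  by rewrite (dual_init HS) sub0r sqrrN.
apply: (@le_trans _ _ (- (potential lam T.+1 - potential lam 1) + T%:R * c)).
  rewrite -telescope_sumr // -sumrN mulr_sumr.
  have -> : T%:R * c = \sum_(1 <= t < T.+1) c.
    by rewrite sumr_const_nat subn1 mulr_natl.
  rewrite -big_split /= !big_nat; apply: ler_sum => t tT.
  exact: potential_step.
rewrite lerD2r opprB /potential.
have := direction_energy_init; have := direction_energy_ge0 T.+1.
have := sqr_ge0 (dual S T.+1 - lam); lra.
Qed.

End Run.

(** * Choice of the multiplier *)

Definition violation_constant {R : realType} (G beta Rad : R) : R :=
  Rad * beta / 2 + beta / (2 * Rad) + beta * Rad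
  + Rad * (beta ^+ 2 + G ^+ 2) / beta + 2 * beta * Rad.

(* With [a = T^(1/4)] and [b = W^(1/4)], the multiplier [a / b] balances the
   terms of order [T / lam] and [lam * sqrt (W * T)]. *)
Lemma osphg_violation_bound (R : realType) (F G beta Rad L a b : R) (T K : nat) :
  1 <= b -> b <= a -> T%:R = a ^+ 4 -> 16 * Rad ^+ 2 <= T%:R ->
  osphg_violation_le F G beta Rad L T (Rad / (beta * (b * a) ^+ 2))
    (4 * beta ^+ 2) K (`|violation_constant G beta Rad| * (b * a ^+ 3)).
Proof.
move=> b1 ba Ta TR n P S HP HC HS.
have b0 : 0 < b by exact: lt_le_trans b1.
have a0 : 0 < a by exact: lt_le_trans ba.
have T0 : (0 < T)%N by rewrite -(ltr0n R) Ta exprn_gt0.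
have ab0 : 0 < (b * a) ^+ 2 by rewrite exprn_gt0 // mulr_gt0.
have mu0 := mu_gt0 HS.
(* If [beta = 0], division by zero would make the step size 0, against [mu_gt0]. *)
have beta_gt0 : 0 < beta.
  rewrite lt_neqAle (beta_ge0 HC T0) andbT eq_sym.
  by apply: contraTneq mu0 => ->; rewrite mul0r invr0 mulr0 ltxx.
have Rad_gt0 : 0 < Rad by move: mu0; rewrite pmulr_lgt0 // invr_gt0 mulr_gt0.
have small : 16 * beta ^+ 2 * (Rad / (beta * (b * a) ^+ 2)) ^+ 2 <= 1.
  have -> : 16 * beta ^+ 2 * (Rad / (beta * (b * a) ^+ 2)) ^+ 2
      = 16 * Rad ^+ 2 / (b * a) ^+ 4.
    by field; rewrite !gt_eqF.
  rewrite ler_pdivrMr ?exprn_gt0 ?mulr_gt0 // mul1r (le_trans TR) // Ta exprMn.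
  by rewrite ler_peMl ?exprn_ge0 ?(ltW a0) // exprn_ege1.
have lam0 : 0 <= a / b by rewrite divr_ge0 ?ltW.
have := violation_le HP HC HS erefl small lam0.
set c := 2 * _ * (a / b).
have c0 : 0 < c by rewrite /c mulr_gt0 ?divr_gt0 // mulr_gt0.
(* The five summands are those of [violation_le], in order, divided by [c = 2 mu lam]. The second
   and third are already of order [b a^3]; the others are dominated because [1 <= b <= a]. *)
rewrite (_ : _ + T%:R * _ = c * (Rad * beta / 2 * (b ^+ 3 * a)
    + beta / (2 * Rad) * (b * a ^+ 3) + beta * Rad * (b * a ^+ 3)
    + Rad * (beta ^+ 2 + G ^+ 2) / beta * (a / b)
    + 2 * beta * Rad * (a ^+ 3 / b ^+ 3))); last first.
  by rewrite /c Ta; field; rewrite !gt_eqF.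
rewrite ler_pM2l // => /le_trans; apply.
apply: (@le_trans _ _ (violation_constant G beta Rad * (b * a ^+ 3))); last first.
  by rewrite ler_wpM2r ?ler_norm // mulr_ge0 ?exprn_ge0 ?ltW.
have Rb0 : 0 <= Rad * beta / 2 by rewrite !mulr_ge0 ?invr_ge0 ?ltW.
have bG0 : 0 <= Rad * (beta ^+ 2 + G ^+ 2) / beta.
  by rewrite !mulr_ge0 ?invr_ge0 ?addr_ge0 ?sqr_ge0 ?ltW.
have bR0 : 0 <= 2 * beta * Rad by rewrite -mulrA mulr_ge0 // mulr_ge0 // ltW.
have a1 : 1 <= a by exact: le_trans ba.
have h1 : b ^+ 3 * a <= b * a ^+ 3.
  rewrite (_ : b ^+ 3 * a = b * a * b ^+ 2) 1?(_ : b * a ^+ 3 = b * a * a ^+ 2); try ring.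
  by rewrite ler_pM2l ?mulr_gt0 // ler_pXn2r ?nnegrE ?(ltW a0) ?(ltW b0).
have h2 : a / b <= b * a ^+ 3.
  rewrite ler_pdivrMr // (_ : _ * b = a * (b * b * a ^+ 2)); last by ring.
  by rewrite ler_peMr ?(ltW a0) // !mulr_ege1 ?exprn_ege1.
have h3 : a ^+ 3 / b ^+ 3 <= b * a ^+ 3.
  rewrite ler_pdivrMr ?exprn_gt0 // mulrC mulrA ler_peMl ?exprn_ge0 ?(ltW a0) //.
  by rewrite mulr_ege1 ?exprn_ege1.
have := ler_wpM2l Rb0 h1; have := ler_wpM2l bG0 h2; have := ler_wpM2l bR0 h3.
rewrite /violation_constant; lra.
Qed.

(** * Real powers and rounded window lengths *)

Lemma powR_quarterK (R : realType) (x : R) : 0 <= x -> (x `^ (1 / 4)) ^+ 4 = x.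
Proof.
move=> x0; rewrite -powR_mulrn ?powR_ge0 // -powRrM.
by rewrite (_ : 1 / 4 * 4%:R = 1) ?powRr1 //; field.
Qed.

Lemma osphg_violation_powR (R : realType) (F G beta Rad L : R) (T W K : nat) :
  (0 < W <= T)%N -> 16 * Rad ^+ 2 <= T%:R ->
  osphg_violation_le F G beta Rad L T
    (Rad / (beta * Num.sqrt (W%:R * T%:R))) (4 * beta ^+ 2) K
    (`|violation_constant G beta Rad| * (W%:R `^ (1 / 4) * T%:R `^ (3 / 4))).
Proof.
move=> /andP[W0 WT] TR.
set b := W%:R `^ (1 / 4); pose a : R := T%:R `^ (1 / 4).
have -> : T%:R `^ (3 / 4) = a ^+ 3 :> R.
  by rewrite -powR_mulrn ?powR_ge0 // -powRrM; congr (_ `^ _); field.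
have -> : Num.sqrt (W%:R * T%:R) = (b * a) ^+ 2 :> R.
  rewrite -(powR_quarterK (ler0n R W)) -(powR_quarterK (ler0n R T)) -exprMn.
  by rewrite (exprM _ 2 2) sqrtr_sqr ger0_norm ?sqr_ge0.
apply: osphg_violation_bound => //; last by rewrite powR_quarterK.
- by rewrite -(powRr0 (W%:R : R)) ler_powR ?ler1n //; lra.
- by rewrite ge0_ler_powR ?nnegrE ?ler_nat //; lra.
Qed.

(** The power [T^(1 - eps)] need not be an integer, so the window is only within 1 of it. As this
    power lies in [1, T], the rounding keeps the window admissible and costs at most a factor 2. *)
Lemma rounded_window (R : realType) (eps : R) (T W : nat) : 0 < eps <= 1 ->
  (0 < T)%N -> `|W%:R - T%:R `^ (1 - eps)| < 1 ->
  (0 < W <= T)%N /\ W%:R <= 2 * T%:R `^ (1 - eps).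
Proof.
move=> /andP[e0 e1] T0; rewrite ltr_norml => /andP[h1 h2].
have T1 : 1 <= T%:R :> R by rewrite ler1n.
have p1 : 1 <= T%:R `^ (1 - eps) by rewrite -[leLHS](powRr0 (T%:R : R)) ler_powR // subr_ge0.
have pT : T%:R `^ (1 - eps) <= T%:R :> R by rewrite ler1_powR // lerBlDr lerDl ltW.
split; last by lra.
apply/andP; split; first by rewrite -(ltr0n R); lra.
by rewrite -ltnS -(ltr_nat R) -natr1; lra.
Qed.

Lemma powR_littleo_id (R : realType) (p : R) : p < 1 ->
  (fun T => T%:R `^ p : R) =o_\oo (fun T => T%:R : R).
Proof.
move=> p1; apply/eqoP => e e0.
near=> T.
have T0 : 0 < T%:R :> R by rewrite ltr0n; near: T; exact: nbhs_infty_gt.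
rewrite !ger0_norm ?powR_ge0 ?(ltW T0) //.
have q0 : 0 < 1 - p by rewrite subr_gt0.
(* Beyond this threshold [e * T^(1 - p) >= 1], and multiplying by [T^p] gives the claim. *)
have : (e^-1 `^ (1 - p)^-1) <= T%:R.
  by apply: ltW; near: T; exact: nbhs_infty_gtr.
move=> /(ge0_ler_powR (ltW q0)); rewrite !nnegrE powR_ge0 (ltW T0) => /(_ isT isT).
rewrite -powRrM mulVf ?gt_eqF // powRr1 ?invr_ge0 ?(ltW e0) // => eT.
rewrite (_ : e * T%:R = e * T%:R `^ (1 - p) * T%:R `^ p); last first.
  rewrite -mulrA -powRD ?subrK ?powRr1 ?(ltW T0) //.
  by rewrite (gt_eqF T0) implybT.
rewrite ler_peMl ?powR_ge0 //.
by rewrite -ler_pdivrMl // mulr1.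
Unshelve. all: by end_near.
Qed.

Theorem theorem4p2 (R : realType) (F G beta Rad L c1 c2 : R)
    (hc1 : 0 < c1) (hc2 : 0 < c2) :
  (exists C : R, forall W K : nat -> nat,
    (forall T, (0 < T)%N -> (0 < W T <= T)%N) ->
    (fun T => (W T)%:R : R) =o_\oo (fun T => T%:R : R) ->
    (\forall T \near \oo,
      c1 * Num.sqrt (T%:R / (W T)%:R) <= (K T)%:R
        <= c2 * Num.sqrt (T%:R / (W T)%:R)) ->
    \forall T \near \oo,
      osphg_violation_le F G beta Rad L T
        (Rad / (beta * Num.sqrt ((W T)%:R * T%:R))) (4 * beta ^+ 2) (K T)
        (C * ((W T)%:R `^ (1 / 4) * T%:R `^ (3 / 4)))) /\
  (exists C : R, forall (eps : R) (W K : nat -> nat),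
    0 < eps <= 1 ->
    (forall T, (0 < T)%N -> `|(W T)%:R - T%:R `^ (1 - eps)| < 1) ->
    (\forall T \near \oo,
      c1 * Num.sqrt (T%:R / (W T)%:R) <= (K T)%:R
        <= c2 * Num.sqrt (T%:R / (W T)%:R)) ->
    (\forall T \near \oo,
      osphg_violation_le F G beta Rad L T
        (Rad / (beta * Num.sqrt ((W T)%:R * T%:R))) (4 * beta ^+ 2) (K T)
        (C * T%:R `^ (1 - eps / 4))) /\
    (fun T => T%:R `^ (1 - eps / 4) : R) =o_\oo (fun T => T%:R : R)).
Proof.
have eventually_large : \forall T \near \oo, (0 < T)%N /\ 16 * Rad ^+ 2 <= T%:R.
  near=> T; split; near: T; first exact: nbhs_infty_gt.
  by apply: filterS (nbhs_infty_gtr (16 * Rad ^+ 2)) => T /ltW.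
(* The absolute value makes [C] nonnegative for arbitrary real [beta] and [Rad], whose signs are not
   known at this point. *)
pose C := `|violation_constant G beta Rad|.
split.
  exists C => W K WT _ _; near=> T.
  have [T0 TR] : (0 < T)%N /\ 16 * Rad ^+ 2 <= T%:R by near: T.
  exact: osphg_violation_powR (WT T T0) TR.
(* Rounding the window costs a factor [2^(1/4)], bounded by 2 uniformly in [eps]. *)
exists (2 * C) => eps W K eps01 WT _; split; last first.
  by apply: powR_littleo_id; move: eps01 => /andP[]; lra.
near=> T => n P S HP HC HS.
have [T0 TR] : (0 < T)%N /\ 16 * Rad ^+ 2 <= T%:R by near: T.
have [WT0 W2] := rounded_window eps01 T0 (WT T T0).
apply: le_trans (osphg_violation_powR WT0 TR HP HC HS) _.
rewrite [2 * C]mulrC -mulrA ler_wpM2l //.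
have -> : T%:R `^ (1 - eps / 4) = (T%:R `^ (1 - eps)) `^ (1 / 4) * T%:R `^ (3 / 4) :> R.
  rewrite -powRrM -powRD; first by congr (_ `^ _); field.
  by rewrite pnatr_eq0 -lt0n T0 implybT.
rewrite mulrA ler_wpM2r ?powR_ge0 //.
have q0 : 0 <= 1 / 4 :> R by lra.
apply: (@le_trans _ _ ((2 * T%:R `^ (1 - eps)) `^ (1 / 4))).
  by rewrite ge0_ler_powR ?nnegrE ?mulr_ge0 ?powR_ge0.
rewrite powRM ?powR_ge0 // ler_wpM2r ?powR_ge0 // ler1_powR //; lra.
Unshelve. all: by end_near.
Qed.
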